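(* Let $G=\langle\sigma,\tau\rangle$ be the Klein four-group, let $\Bbbk$ be a field of characteristic $2$, and let $\chi=\{\langle\sigma\rangle,\langle\tau\rangle,\langle\sigma\tau\rangle\}$. Let $N\cong V_{2n+1}$ for some $n\ge0$. Then: (1) $\dim H^0_\chi(G,N)=n$ if $n>0$, and $\dim H^0_\chi(G,N)=1$ if $n=0$; (2) $\dim H^i_\chi(G,N)=\max(0,n+2i-3)$ for all $i>0$.
   Context: All modules are finitely generated. Put $X=\sigma-1$, $Y=\tau-1\in\Bbbk G$, so $\Bbbk G\cong\Bbbk[X,Y]/(X^2,Y^2)$. For $n\ge0$, $V_{2n+1}$ is the $(2n+1)$-dimensional module with basis $a_0,\dots,a_n,b_1,\dots,b_n$ and $Ya_{i-1}=b_i$, $Xa_i=b_i$ ($1\le i\le n$), $Xa_0=0$, $Ya_n=0$, $Xb_i=Yb_i=0$; so $V_1=\Bbbk$ is the trivial module. A $\Bbbk G$-module $M$ is projective relative to $\chi$ if it is a direct summand of $\bigoplus_{H\in\chi} M\downarrow_H\uparrow^G$. Relative cohomology $H^i_\chi(G,N)=\mathrm{Ext}^i_{\Bbbk G,\chi}(\Bbbk,N)$ is the $i$-th homology of the complex $0\to\mathrm{Hom}_{\Bbbk G}(Q_0,N)\to\mathrm{Hom}_{\Bbbk G}(Q_1,N)\to\cdots$, where $\cdots\to Q_1\to Q_0\to\Bbbk\to 0$ is a relative projective resolution of the trivial module: an exact complex in which each $Q_i$ is projective relative to $\chi$ and the connecting homomorphisms split over each $H\in\chi$ (i.e. the complex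 is split exact on restriction to each $H\in\chi$). It is independent of the choice of resolution. *)

(* Defs.v *)
From mathcomp Require Import all_boot all_order all_algebra all_fingroup.
From mathcomp Require Import all_solvable all_field all_character.

Set Implicit Arguments.
Unset Strict Implicit.
Unset Printing Implicit Defensive.

Import GroupScope GRing.Theory.
Local Open Scope ring_scope.

(* The ambient finite group is the whole of [gT : finGroupType].  As in
   mxrepresentation.v, modules are spaces of row vectors: [u *m rG g] is the
   result of letting g act on u, and [u *m f] is the image of u by f.  Group
   elements thus act on the right, which is harmless for abelian groups. *)

Section RelativeCohomology.

Variables (k : fieldType) (gT : finGroupType).

Local Notation grepr := (representation k [set: gT]).

Section Induction.

Variables (H : {group gT}) (n : nat) (rH : mx_representation k H n).

Definition coset_rep (i : 'I_#|[set: gT] : H|) : gT :=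
  repr (enum_val i).

(* M (x)_kH kG is the direct sum of the M (x) t_i, where (t_i) is a
   right transversal of H, and (m (x) t_i) x = m h (x) t_j for
   t_i x = h t_j with h in H. *)
Definition induced_mx (x : gT) : 'M[k]_(\sum_(i < #|[set: gT] : H|) n) :=
  \mxblock_(i, j)
    let h := (coset_rep i * x * (coset_rep j)^-1)%g in
    if h \in H then rH h else 0.

Lemma coset_repP x :
  exists i, forall j, ((x * (coset_rep j)^-1)%g \in H) = (j == i).
Proof.
have Hx : H :* x \in rcosets H [set: gT].
  by apply/rcosetsP; exists x; rewrite ?inE.
exists (enum_rank_in Hx (H :* x)) => j.
have Dj : H :* coset_rep j = enum_val j.
  have /rcosetsP[y _ Dy] := enum_valP j.
  by rewrite /coset_rep Dy; apply/rcoset_eqP/mem_repr_rcoset.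
rewrite -mem_rcoset -(inj_eq enum_val_inj) enum_rankK_in // -Dj.
by rewrite eq_sym; apply/idP/eqP => /rcoset_eqP.
Qed.

Lemma induced_mx_repr : mx_repr [set: gT] induced_mx.
Proof.
split=> [|x y _ _].
  rewrite -mxdiagZ; apply: eq_mxblock => i j /=; rewrite mulg1.
  have [l Hl] := coset_repP (coset_rep i).
  have /eqP Dl : i == l by rewrite -Hl mulgV group1.
  rewrite Hl -Dl eq_sym; case: eqP => // <-.
  by rewrite mulgV repr_mx1 conform_mx_id.
rewrite /induced_mx mul_mxblock; apply: eq_mxblock => i j /=.
have [l Hl] := coset_repP (coset_rep i * x).
rewrite (bigD1 l) //= Hl eqxx big1 ?addr0 => [|l' /negPf l'l]; last first.
  by rewrite Hl l'l mul0mx.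
have Hil : (coset_rep i * x * (coset_rep l)^-1)%g \in H by rewrite Hl.
rewrite (_ : (coset_rep i * (x * y) * _)%g =
  (coset_rep i * x * (coset_rep l)^-1 * (coset_rep l * y * (coset_rep j)^-1))%g).
  rewrite groupMl //; case: ifP => Hlj; last by rewrite mulmx0.
  by rewrite repr_mxM.
by rewrite !mulgA mulgKV.
Qed.

Definition induced_repr : grepr :=
  Representation (MxRepresentation induced_mx_repr).

End Induction.

Implicit Types M N : grepr.

Definition res_ind (H : {group gT}) M : grepr :=
  induced_repr (subg_repr M (subsetT H)).

Definition hom_space (A : {set gT}) M N : {vspace 'M[k]_(rdegree M, rdegree N)} :=
  (\bigcap_(x in A) lker (linfun (mulmx (M x)) - linfun (mulmxr (N x))))%VS.

Lemma hom_spaceP (A : {set gT}) M N f :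
  reflect (forall x, x \in A -> M x *m f = f *m N x) (f \in hom_space A M N).
Proof.
rewrite memvE; apply: (iffP subv_bigcapP) => Hf x Ax; have := Hf x Ax.
  by rewrite -memvE memv_ker add_lfunE opp_lfunE !lfunE subr_eq0 => /eqP.
by move=> e; rewrite -memvE memv_ker add_lfunE opp_lfunE !lfunE /= e subrr.
Qed.

Definition trivial_mx (x : gT) : 'M[k]_1 := 1%:M.

Lemma trivial_mx_repr : mx_repr [set: gT] trivial_mx.
Proof. by split=> // x y _ _; rewrite mulmx1. Qed.

Definition trivial_repr : grepr :=
  Representation (MxRepresentation trivial_mx_repr).

Variable chi : {set {group gT}}.

Definition rel_projective M : Prop :=
  exists M', mx_rsim (\big[dadd_grepr/grepr0]_(H in chi) res_ind H M)
                     (dadd_grepr M M').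

(* A map f splits when f s f = f for some s in the opposite direction; for an
   exact complex, all differentials being split means that the complex is
   split exact. *)
Definition rel_split M N (f : 'M[k]_(rdegree M, rdegree N)) : Prop :=
  forall H, H \in chi -> exists2 s, s \in hom_space H N M & f *m s *m f = f.

Record rel_resolution M := RelResolution {
  res_obj :> nat -> grepr;
  res_aug : 'M[k]_(rdegree (res_obj 0), rdegree M);
  res_diff : forall i, 'M[k]_(rdegree (res_obj i.+1), rdegree (res_obj i));
  res_aug_hom : res_aug \in hom_space [set: gT] (res_obj 0) M;
  res_diff_hom : forall i,
    res_diff i \in hom_space [set: gT] (res_obj i.+1) (res_obj i);
  res_projective : forall i, rel_projective (res_obj i);
  res_aug_surj : row_full res_aug;
  res_exact0 : (res_diff 0 :=: kermx res_aug)%MS;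
  res_exact : forall i, (res_diff i.+1 :=: kermx (res_diff i))%MS;
  res_aug_split : rel_split res_aug;
  res_diff_split : forall i, rel_split (res_diff i)
}.

Section Ext.

Variables (M N : grepr) (Q : rel_resolution M).

Definition cochain_diff i :
    'Hom('M[k]_(rdegree (Q i), rdegree N), 'M[k]_(rdegree (Q i.+1), rdegree N)) :=
  linfun (mulmx (res_diff Q i)).

Definition cocycles i : {vspace 'M[k]_(rdegree (Q i), rdegree N)} :=
  (hom_space [set: gT] (Q i) N :&: lker (cochain_diff i))%VS.

Definition coboundaries i : {vspace 'M[k]_(rdegree (Q i), rdegree N)} :=
  if i is j.+1 then (cochain_diff j @: hom_space [set: gT] (Q j) N)%VS else 0%VS.

Lemma coboundaries_sub i : (coboundaries i <= cocycles i)%VS.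
Proof.
case: i => [|i]; first exact: sub0v.
apply/subvP => _ /memv_imgP[f /hom_spaceP Hf ->].
rewrite memv_cap memv_ker /cochain_diff !lfunE /= mulmxA; apply/andP; split.
  apply/hom_spaceP => x Gx; rewrite mulmxA.
  by have /hom_spaceP-> := res_diff_hom Q i; rewrite // -!mulmxA Hf.
rewrite (_ : _ *m res_diff Q i = 0) ?mul0mx //.
by apply/sub_kermxP; rewrite -res_exact.
Qed.

(* Dimension of the quotient cocycles i / coboundaries i; the subtraction is
   exact by [coboundaries_sub]. *)
Definition rel_ext_dim i : nat := (\dim (cocycles i) - \dim (coboundaries i))%N.

End Ext.

End RelativeCohomology.

Definition klein_four (gT : finGroupType) (sigma tau : gT) : Prop :=
  [/\ 2%N.-abelem [set: gT], #|[set: gT]| = 4%N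
    & <<[set sigma; tau]>> = [set: gT]].

Lemma klein_fourC (gT : finGroupType) (sigma tau : gT) :
  klein_four sigma tau -> klein_four tau sigma.
Proof. by case=> abG oG genG; split; rewrite // setUC. Qed.

Lemma klein_four_order (gT : finGroupType) (sigma tau : gT) :
  klein_four sigma tau -> #[tau]%g = 2%N.
Proof.
case=> abG oG genG; have [_ exp2] := abelemP (isT : prime 2) abG.
have le2 (x : gT) : (#[x]%g <= 2)%N.
  by rewrite dvdn_leq // order_dvdn exp2 ?inE.
apply/eqP; rewrite eqn_leq le2 ltnNge; apply/negP => o1.
have /eqP t1 : tau == 1%g by rewrite -order_eq1 eqn_leq o1 order_gt0.
have: (#|<<[set sigma; tau]>>| <= #[sigma]%g)%N.
  by rewrite subset_leq_card // gen_subG t1 subUset !sub1set cycle_id group1.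
by rewrite genG oG => /leq_trans/(_ (le2 _)).
Qed.

Lemma klein_four_notin (gT : finGroupType) (sigma tau x y : gT) :
    klein_four sigma tau ->
  ((x * y)%g \notin <[tau]>) = (x \notin <[tau]>) (+) (y \notin <[tau]>).
Proof.
move=> Gkl; have [_ oG _] := Gkl.
have iT : #|[set: gT] : <[tau]>| = 2%N.
  by rewrite -divgS ?subsetT // oG -orderE (klein_four_order Gkl).
have [Tx | T'x] := boolP (x \in _); first by rewrite groupMl.
have [Ty | T'y] := boolP (y \in _); first by rewrite groupMr // T'x.
apply/negPn; rewrite -[y]invgK -mem_rcoset.
by rewrite (rcoset_index2 (subsetT _) iT) !inE ?andbT ?groupV.
Qed.

Lemma klein_four_sigma (gT : finGroupType) (sigma tau : gT) :
  klein_four sigma tau -> sigma \notin <[tau]>.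
Proof.
move=> Gkl; have [_ oG genG] := Gkl; apply/negP => Ts.
have: (#|<<[set sigma; tau]>>| <= #[tau]%g)%N.
  by rewrite subset_leq_card // gen_subG subUset !sub1set Ts cycle_id.
by rewrite genG oG (klein_four_order Gkl).
Qed.

Section KleinFourModules.

Variables (k : fieldType) (gT : finGroupType) (sigma tau : gT).
Hypotheses (Gkl : klein_four sigma tau) (chark2 : 2%N \in [pchar k]).

Variable n : nat.

(* The first n+1 basis vectors are a_0, ..., a_n and the last n are
   b_1, ..., b_n, so that b_(j+1) has index j : 'I_n. *)
Definition VX_mx : 'M[k]_(n.+1 + n) :=
  block_mx 0 (\matrix_(i < n.+1, j < n) (i == j.+1 :> nat)%:R) 0 0.

Definition VY_mx : 'M[k]_(n.+1 + n) :=
  block_mx 0 (\matrix_(i < n.+1, j < n) (i == j :> nat)%:R) 0 0.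

(* [g \notin <[tau]>] (resp. [g \notin <[sigma]>]) is the exponent mod 2 of
   sigma (resp. tau) in g, and X Y = 0 on the module. *)
Definition V_mx (g : gT) : 'M[k]_(n.+1 + n) :=
  1%:M + (g \notin <[tau]>)%:R *: VX_mx + (g \notin <[sigma]>)%:R *: VY_mx.

Lemma V_mx_repr : mx_repr [set: gT] V_mx.
Proof.
split=> [|x y _ _]; first by rewrite /V_mx !group1 !scale0r !addr0.
have addF2 (a b : bool) : (a (+) b)%:R = a%:R + b%:R :> k.
  have two0 : 1 + 1 = 0 :> k by exact: pcharf0 chark2.
  by case: a b => [] []; rewrite ?two0 ?addr0 ?add0r.
rewrite /V_mx (klein_four_notin _ _ Gkl).
rewrite (klein_four_notin _ _ (klein_fourC Gkl)) !addF2 !scalerDl.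
rewrite !mulmxDl !mulmxDr !(mul1mx, mulmx1) -!scalemxAl -!scalemxAr.
rewrite !mulmx_block !(mulmx0, mul0mx, addr0) block_mx0 !scaler0 !addr0.
rewrite -!addrA; congr (_ + _); rewrite addrCA; congr (_ + _).
by rewrite [RHS]addrC addrA.
Qed.

Definition V_repr : representation k [set: gT] :=
  Representation (MxRepresentation V_mx_repr).

Lemma V_repr_sigma : V_repr sigma = 1%:M + VX_mx.
Proof.
by rewrite /= /V_mx klein_four_sigma // cycle_id scale1r scale0r addr0.
Qed.

Lemma V_repr_tau : V_repr tau = 1%:M + VY_mx.
Proof.
rewrite /= /V_mx cycle_id (klein_four_sigma (klein_fourC Gkl)).
by rewrite scale1r scale0r addr0.
Qed.

End KleinFourModules.

(* Main.v *)
Require Import Defs.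
From mathcomp Require Import all_boot all_order all_algebra all_fingroup.
From mathcomp Require Import all_solvable all_field all_character.
From mathcomp Require Import zify.

Import GroupScope Order.TTheory GRing.Theory Num.Theory.
Local Open Scope ring_scope.

Set Implicit Arguments.
Unset Strict Implicit.
Unset Printing Implicit Defensive.

(** Write G for the Klein four-group, V n for the module of dimension 2n+1 and
    H^i(N) for the relative cohomology of G with coefficients in N. The proof
    is a dimension shift in the coefficient module: for every n there is an
    exact sequence

          0 -> V n -> F n -> V (n+2) -> 0

    that splits over each of the three subgroups of order 2, and whose middle
    term has no relative cohomology in positive degrees. Hence H^(i+2)(V n) has the
    dimension of H^(i+1)(V (n+2)), and H^1(V n) has dimension

          dim (V n)^G + dim (V (n+2))^G - dim (F n)^G
            = max(n, 1) + (n+2) - (n+3) = max(n-1, 0).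

    Induction on i gives n+2i-3, truncated at 0, in every degree i > 0, while
    H^0 is the space of fixed points. The shift amounts to counting dimensions
    of cocycles and coboundaries in the complexes Hom_G(Q, N), for an arbitrary
    resolution Q.

    Relative projectivity enters through Higman's criterion: the identity is a
    sum of relative traces of H-endomorphisms, H in chi. For the terms of Q
    this makes Hom_G(Q_i, -) exact on sequences that split over each H
    (push_surj); for F n it turns the contracting homotopies of Q over each H
    into a contraction of Hom_G(Q, F n) (higman_coboundaries).

    The sequence has a transparent description in terms of polynomials. Think
    of a_i as the monomial x^i y^(n-i) and of b_i as x^(i-1) y^(n-i); on V n,
    X = sigma - 1 and Y = tau - 1 divide monomials by x and by y, the result
    being 0 when the division is impossible. On the space V (n+2) + V n, with
    monomials of degrees n+2, n+1, n and n-1, let X act as division by x plus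
    division by x^2, where the latter maps V (n+2) to V n, and let Y act in the
    same way with y. As x^2, y^2 and (x+y)^2 are squares, the sequence splits
    over <sigma>, <tau> and <sigma tau> by division by x, y and x+y
    (section_hom, section_hom_st). On the other hand XY acts on the monomials
    of degree n+2 as division by xy(x+y), the product of the three lines, and
    F n is the sum of n copies of the group algebra and of one copy of each
    k[G/H]; this is what the endomorphisms theta_sigma, theta_tau and theta_st
    express (ext_higman). *)

(** * Equivariant maps *)
Section HomSpace.

Variables (k : fieldType) (gT : finGroupType).
Implicit Types M N : representation k [set: gT].

Lemma hom_space_gen (A : {set gT}) M N (f : 'M_(rdegree M, rdegree N)) :
  (forall x, x \in A -> M x *m f = f *m N x) -> f \in hom_space <<A>>%g M N.
Proof.
move=> Af; have Cf : group_set [set x | M x *m f == f *m N x].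
  apply/group_setP; split=> [|x y]; rewrite !inE.
    by rewrite !repr_mx1 mulmx1 mul1mx.
  move=> /eqP fx /eqP fy.
  by rewrite !repr_mxM ?inE // -mulmxA fy mulmxA fx mulmxA.
apply/hom_spaceP => x; rewrite -[<<A>>%g]/(gval <<A>>%G) => Ax.
suff: x \in Group Cf by rewrite inE => /eqP.
apply: subsetP Ax; rewrite gen_subG; apply/subsetP => y Ay.
by rewrite inE Af.
Qed.

Lemma hom_spaceS (A B : {set gT}) M N (f : 'M_(rdegree M, rdegree N)) :
  A \subset B -> f \in hom_space B M N -> f \in hom_space A M N.
Proof.
by move=> /subsetP sAB /hom_spaceP Bf; apply/hom_spaceP => x /sAB; apply: Bf.
Qed.

Lemma hom_spaceM (A : {set gT}) L M N (f : 'M_(rdegree L, rdegree M)) g :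
  f \in hom_space A L M -> g \in hom_space A M N ->
  f *m g \in hom_space A L N.
Proof.
move=> /hom_spaceP Af /hom_spaceP Ag; apply/hom_spaceP => x Ax.
by rewrite mulmxA Af // -!mulmxA Ag.
Qed.

End HomSpace.

(** * Higman's criterion for an elementary abelian 2-group

    The subgroups in chi all have index 2, and t picks an element outside each
    of them. *)
Section Higman.

Variables (k : fieldType) (gT : finGroupType) (chi : {set {group gT}}).
Variable t : {group gT} -> gT.
Hypotheses (chark2 : 2%N \in [pchar k]) (abG : 2%N.-abelem [set: gT]).
Hypothesis index2 : forall H, H \in chi -> #|[set: gT] : H| = 2%N.
Hypothesis t_notin : forall H, H \in chi -> t H \notin H.

Local Notation grepr := (representation k [set: gT]).
Implicit Types (M N : grepr) (H : {group gT}).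

Let abelT : abelian [set: gT] := abelem_abelian abG.

Lemma addmm2 m n (A : 'M[k]_(m, n)) : A + A = 0.
Proof.
have two0 : 1 + 1 = 0 :> k by exact: pcharf0 chark2.
by rewrite -[A]scale1r -scalerDl two0 scale0r.
Qed.

Lemma repr_sqr M x : M x *m M x = 1%:M.
Proof.
have [_ exp2] := abelemP (isT : prime 2) abG.
by rewrite -repr_mxM ?inE // -expg2 exp2 ?inE // repr_mx1.
Qed.

Lemma index2_notin H x y :
  H \in chi -> ((x * y)%g \notin H) = (x \notin H) (+) (y \notin H).
Proof.
move=> chiH; have [Hx | H'x] := boolP (x \in H); first by rewrite groupMl.
have [Hy | H'y] := boolP (y \in H); first by rewrite groupMr // H'x.
apply/negPn; rewrite -[y]invgK -mem_rcoset.
by rewrite (rcoset_index2 (subsetT _) (index2 chiH)) !inE ?andbT ?groupV.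
Qed.

(** For t outside H and f an H-map, this is the relative trace from H to G of
    the H-map obtained by applying t after f: the two cosets of H contribute
    f t and t^-1 (f t) t = t f, as t has order 2. *)
Definition rel_trace g M N (f : 'M[k]_(rdegree M, rdegree N)) :
    'M[k]_(rdegree M, rdegree N) :=
  M g *m f + f *m N g.
Arguments rel_trace : clear implicits.

Lemma rel_trace_hom H M N f :
  H \in chi -> f \in hom_space H M N ->
  rel_trace (t H) M N f \in hom_space [set: gT] M N.
Proof.
move=> chiH /hom_spaceP Hf; set F := rel_trace _ _ _ _.
have genT : <<t H |: H>>%g = [set: gT].
  apply/eqP; rewrite eqEsubset subsetT; apply/subsetP => x _.
  have [Hx | H'x] := boolP (x \in H).
    by rewrite mem_gen // setU1r.
  rewrite -[x](mulgKV (t H)) groupM ?mem_gen ?setU11 //.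
  by rewrite setU1r // -[_ \in H]negbK index2_notin // groupV H'x t_notin.
rewrite -genT; apply: hom_space_gen => x; rewrite !inE => /predU1P[-> | Hx].
  rewrite /F /rel_trace mulmxDr mulmxDl !mulmxA repr_sqr mul1mx.
  by rewrite -[f *m _ *m _]mulmxA repr_sqr mulmx1 addrC.
have comm_t (L : grepr) : L x *m L (t H) = L (t H) *m L x.
  by rewrite -!repr_mxM ?inE // (centsP abelT) ?inE.
rewrite /F /rel_trace mulmxDr mulmxDl !mulmxA comm_t Hf // -!mulmxA comm_t.
by rewrite Hf.
Qed.

Lemma mul_rel_trace g L M N f1 f2 :
  f1 \in hom_space [set: gT] L M ->
  f1 *m rel_trace g M N f2 = rel_trace g L N (f1 *m f2).
Proof.
move/hom_spaceP => Gf1.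
by rewrite /rel_trace mulmxDr !mulmxA Gf1 ?inE.
Qed.

Lemma rel_trace_mul g L M N f1 f2 :
  f2 \in hom_space [set: gT] M N ->
  rel_trace g L M f1 *m f2 = rel_trace g L N (f1 *m f2).
Proof.
move/hom_spaceP => Gf2.
by rewrite /rel_trace mulmxDl -!mulmxA Gf2 ?inE.
Qed.

(** Higman's criterion: the identity is a sum of relative traces. Being
    symmetric in source and target, it gives liftings along surjections that
    split over each H as well as extensions along such injections. *)
Definition higman M := exists2 theta : {group gT} -> 'M[k]_(rdegree M),
  forall H, H \in chi -> theta H \in hom_space H M M &
  \sum_(H in chi) rel_trace (t H) M M (theta H) = 1%:M.

Lemma higman_retract M N f g :
  f \in hom_space [set: gT] M N -> g \in hom_space [set: gT] N M ->
  f *m g = 1%:M -> higman N -> higman M.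
Proof.
move=> Gf Gg fg1 [theta Htheta sum1].
exists (fun H => f *m theta H *m g) => [H chiH|].
  by rewrite !(hom_spaceM (M := N)) ?Htheta // (hom_spaceS (subsetT _)).
rewrite -fg1 -[f in RHS]mulmx1 -sum1 mulmx_sumr mulmx_suml.
by apply: eq_bigr => H _; rewrite mul_rel_trace // rel_trace_mul.
Qed.

Lemma higman0 : higman grepr0.
Proof.
by exists (fun _ => 0) => [H _|]; [exact: mem0v | apply/matrixP; case].
Qed.

Lemma higman_dadd M N : higman M -> higman N -> higman (dadd_grepr M N).
Proof.
move=> [theta Htheta sum1] [eta Heta sum1'].
exists (fun H => block_mx (theta H) 0 0 (eta H)) => [H chiH|].
  apply/hom_spaceP => x Hx; rewrite !mulmx_block.
  rewrite !(mulmx0, mul0mx, addr0, add0r).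
  have /hom_spaceP-> // := Htheta H chiH.
  by have /hom_spaceP-> // := Heta H chiH.
rewrite [RHS]scalar_mx_block -sum1 -sum1'.
elim/big_rec3: _ => [|H A B C chiH ->].
  by rewrite -[0 in RHS]/0 block_mx0.
rewrite /rel_trace !mulmx_block !(mulmx0, mul0mx, addr0, add0r).
by rewrite !add_block_mx !addr0.
Qed.

(** Let e be the projection of the induced module onto the summand of the
    trivial coset. Since t swaps the two cosets of H, t e + e t = t; for
    theta = e t this gives t theta + theta t = (t e + e t) t = t^2 = 1. *)
Lemma higman_res_ind H M : H \in chi -> higman (res_ind H M).
Proof.
move=> chiH; set I := res_ind H M.
pose c (i : 'I_#|[set: gT] : H|) : k := (coset_rep i \in H)%:R.
pose e : 'M[k]_(rdegree I) := \mxdiag_i ((c i)%:M : 'M_(rdegree M)).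
have mul_e x : (x \in H -> I x *m e = e *m I x) /\
               (x \notin H -> I x *m e + e *m I x = I x).
  rewrite {1 2 3 4 5}/I /= /e mul_mxblock_mxdiag mul_mxdiag_mxblock.
  have inH (i j : 'I_#|[set: gT] : H|) :
    (coset_rep i * x * (coset_rep j)^-1)%g \in H ->
    (coset_rep i \in H) (+) (coset_rep j \in H) = (x \notin H).
    move/negPn; rewrite !index2_notin // groupV.
    by do 3!case: (_ \in H).
  rewrite -mxblockD.
  split=> Hx; apply: eq_mxblock => i j /=; case: ifP => Hij;
    rewrite ?(mul0mx, mulmx0, addr0) // mul_mx_scalar mul_scalar_mx.
    by congr (_ *: _); move: (inH i j Hij); rewrite /c Hx; do 2!case: (_ \in H).
  rewrite -scalerDl; move: (inH i j Hij); rewrite /c Hx.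
  by do 2!case: (_ \in H) => //; rewrite ?addr0 ?add0r scale1r.
exists (fun H' => if H' == H then e *m I (t H) else 0) => [H' chiH'|].
  case: eqP => [->|_]; last exact: mem0v.
  apply: (hom_spaceM (M := I)); apply/hom_spaceP => x Hx.
    by have [-> ] := mul_e x.
  by rewrite -!repr_mxM ?inE // (centsP abelT) ?inE.
rewrite (bigD1 H) //= eqxx [X in _ + X = _]big1 ?addr0
  => [|H' /andP[_ /negPf->]]; last first.
  by rewrite /rel_trace mul0mx mulmx0 addr0.
rewrite /rel_trace mulmxA -mulmxDl.
have [_ /(_ (t_notin chiH)) ->] := mul_e (t H).
exact: (repr_sqr I).
Qed.

Lemma rel_projective_higman M : rel_projective chi M -> higman M.
Proof.
case=> M'; set S := \big[_/_]_(H in chi) _ => /mx_rsim_sym[B eqn freeB homB].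
have higS : higman S.
  rewrite /S; apply: (big_ind higman); first exact: higman0.
    exact: higman_dadd.
  exact: (fun H => @higman_res_ind H M).
have fullB : row_full B.
  by rewrite /row_full (eqP freeB); apply/eqP.
apply: (@higman_retract _ S (row_mx 1%:M 0 *m B)
  (pinvmx B *m col_mx 1%:M 0) _ _ _ higS).
- apply/hom_spaceP => x Gx.
  rewrite -mulmxA -homB // !mulmxA; congr (_ *m B).
  by rewrite mul_mx_row mul_row_block !(mulmx0, mul0mx, addr0, mul1mx, mulmx1).
- apply/hom_spaceP => x Gx.
  have homBi : S x *m pinvmx B = pinvmx B *m dadd_grepr M M' x.
    rewrite -[S x]mul1mx -(mulVpmx fullB) -[_ *m S x]mulmxA -homB // -!mulmxA.
    by rewrite mulmxVp // mulmx1.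
  rewrite mulmxA homBi -!mulmxA; congr (_ *m _).
  by rewrite mul_block_col mul_col_mx !(mulmx0, mul0mx, addr0, mul1mx, mulmx1).
rewrite mulmxA -[_ *m B *m _]mulmxA mulmxVp // mulmx1.
by rewrite mul_row_col mulmx1 mulmx0 addr0.
Qed.

(** * Relative cohomology and dimension shift *)
Section Cohomology.

Variables (M : grepr) (Q : rel_resolution chi M).

Lemma res_higman i : higman (Q i).
Proof. exact/rel_projective_higman/res_projective. Qed.

Lemma mem_cocycles N i f :
  (f \in cocycles N Q i) =
    (f \in hom_space [set: gT] (Q i) N) && (res_diff Q i *m f == 0).
Proof. by rewrite memv_cap memv_ker /cochain_diff lfunE. Qed.

Lemma dim_cochains N i :
  (\dim (cocycles N Q i) + \dim (coboundaries N Q i.+1))%N =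
  \dim (hom_space [set: gT] (Q i) N).
Proof. exact: limg_ker_dim. Qed.

(** Over H, a cocycle f is d s f for the given H-splitting s of d. When the
    identity of N is a sum of traces of theta_H, then f is the sum of the traces
    of d s f theta_H, that is d applied to the sum of the traces of
    s f theta_H. *)
Lemma higman_coboundaries N i :
  higman N -> coboundaries N Q i.+1 = cocycles N Q i.+1.
Proof.
case=> theta Htheta sum1; apply/eqP; rewrite eqEsubv coboundaries_sub /=.
apply/subvP => f; rewrite mem_cocycles => /andP[Gf /eqP df0].
rewrite -[f]mulmx1 -sum1 mulmx_sumr; apply: memv_suml => H chiH.
have [s Hs dsd] := res_diff_split Q i chiH.
have Gd := res_diff_hom Q i.
rewrite (mul_rel_trace _ _ Gf).
(* 1 - d s maps to the kernel of d, which is the image of the next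
   differential, and f vanishes there. *)
have -> : f = res_diff Q i *m (s *m f).
  apply/eqP; rewrite mulmxA -subr_eq0 -{1}[f]mul1mx -mulmxBl.
  have /submxP[D ->] : (1%:M - res_diff Q i *m s <= res_diff Q i.+1)%MS.
    by rewrite res_exact; apply/sub_kermxP; rewrite mulmxBl mul1mx dsd subrr.
  by rewrite -mulmxA df0 mulmx0.
rewrite -mulmxA -(mul_rel_trace _ _ Gd).
rewrite -[_ *m rel_trace _ _ _ _](lfunE (mulmx (res_diff Q i))).
apply: memv_img; apply: rel_trace_hom => //.
rewrite (hom_spaceM (M := N)) ?Htheta // (hom_spaceM Hs) //.
by rewrite (hom_spaceS (subsetT _)).
Qed.

(** Maps on Q_0 that vanish on the image of Q_1 factor through the
    augmentation. *)
Lemma dim_cocycles0 N :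
  \dim (cocycles N Q 0) = \dim (hom_space [set: gT] M N).
Proof.
have Ga := res_aug_hom Q; have aK := mulVpmx (res_aug_surj Q).
set a := res_aug Q in Ga aK *.
have inj_a : lker (linfun (mulmx a) : 'Hom(_, 'M[k]_(_, rdegree N))) == 0%VS.
  by apply/lker0P => u v; rewrite !lfunE /= => /(congr1 (mulmx (pinvmx a)));
     rewrite !mulmxA aK !mul1mx.
rewrite -(limg_dim_eq (f := linfun (mulmx a))); last first.
  by rewrite (eqP inj_a) capv0.
congr (\dim _); apply/eqP; rewrite eqEsubv; apply/andP; split; apply/subvP.
  move=> f; rewrite mem_cocycles => /andP[Gf /eqP df0].
  have Df : f = a *m (pinvmx a *m f).
    apply/eqP; rewrite mulmxA -subr_eq0 -{1}[f]mul1mx -mulmxBl.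
    have /submxP[D ->] : (1%:M - a *m pinvmx a <= res_diff Q 0)%MS.
      rewrite res_exact0; apply/sub_kermxP.
      by rewrite mulmxBl mul1mx -mulmxA aK mulmx1 subrr.
    by rewrite -mulmxA df0 mulmx0.
  rewrite Df -[a *m _](lfunE (mulmx a)); apply: memv_img.
  apply/hom_spaceP => x Gx.
  have := hom_spaceP _ _ Gf x Gx; rewrite {1 2}Df [Q 0%N x *m _]mulmxA.
  rewrite (hom_spaceP _ _ Ga x Gx) -!mulmxA => /(congr1 (mulmx (pinvmx a))).
  by rewrite !mulmxA aK !mul1mx.
move=> _ /memv_imgP[v Gv ->]; rewrite lfunE mem_cocycles (hom_spaceM Ga) //=.
suff da0 : res_diff Q 0 *m a = 0 by rewrite mulmxA da0 mul0mx.
by apply/sub_kermxP; rewrite -res_exact0.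
Qed.

Section DimensionShift.

Variables (A I C : grepr).
Variables (iota : 'M[k]_(rdegree A, rdegree I)).
Variables (pi : 'M[k]_(rdegree I, rdegree C)).
Hypotheses (Giota : iota \in hom_space [set: gT] A I).
Hypotheses (free_iota : row_free iota).
Hypotheses (Gpi : pi \in hom_space [set: gT] I C).
Hypothesis exact_iota : (iota :=: kermx pi)%MS.
Hypothesis split_pi :
  forall H, H \in chi -> exists2 s, s \in hom_space H C I & s *m pi = 1%:M.

Local Notation pi_lfun P :=
  (linfun (mulmxr pi) : 'Hom('M[k]_(rdegree P, _), 'M[k]_(rdegree P, _))).
Local Notation iota_lfun P :=
  (linfun (mulmxr iota) : 'Hom('M[k]_(rdegree P, _), 'M[k]_(rdegree P, _))).

Lemma ker_push P (f : 'M_(rdegree P, rdegree I)) :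
  f \in hom_space [set: gT] P I -> f *m pi = 0 ->
  exists2 g, g \in hom_space [set: gT] P A & f = g *m iota.
Proof.
move=> Gf fpi0.
have Df : f *m pinvmx iota *m iota = f.
  by apply: mulmxKpV; rewrite exact_iota; apply/sub_kermxP.
exists (f *m pinvmx iota) => //; apply/hom_spaceP => x Gx.
apply: (row_free_inj free_iota).
rewrite -[_ *m A x *m _]mulmxA (hom_spaceP _ _ Giota) // [in RHS]mulmxA Df.
by rewrite -mulmxA Df (hom_spaceP _ _ Gf).
Qed.

(** If the identity of P is a sum of traces of theta_H and s_H is an H-section
    of pi, then f is the sum of the traces of theta_H f s_H, followed by pi. *)
Lemma push_surj P : higman P ->
  (pi_lfun P @: hom_space [set: gT] P I)%VS = hom_space [set: gT] P C.
Proof.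
case=> theta Htheta sum1; apply/eqP; rewrite eqEsubv.
apply/andP; split; apply/subvP.
  by move=> _ /memv_imgP[f Gf ->]; rewrite lfunE; apply: hom_spaceM Gpi.
move=> f Gf; rewrite -[f]mul1mx -sum1 mulmx_suml.
apply: memv_suml => H chiH; have [s Hs spi1] := split_pi chiH.
rewrite (rel_trace_mul _ _ Gf) -[f]mulmx1 -spi1 !mulmxA.
rewrite -(rel_trace_mul _ _ Gpi) -[_ *m pi](lfunE (mulmxr pi)).
apply: memv_img; apply: rel_trace_hom => //; apply: hom_spaceM Hs.
by apply: hom_spaceM (Htheta _ chiH) _; apply: hom_spaceS Gf; apply: subsetT.
Qed.

(** Left exactness of Hom, stated for arbitrary subspaces so that it applies to
    cocycles as well as to cochains. *)
Lemma dim_ker_push P (U : {vspace 'M_(rdegree P, rdegree A)})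
    (W : {vspace 'M_(rdegree P, rdegree I)}) :
  (forall f, (f \in U) = (f *m iota \in W)) ->
  (W <= hom_space [set: gT] P I)%VS ->
  \dim (W :&: lker (pi_lfun P)) = \dim U.
Proof.
move=> UW sWG; rewrite -(limg_dim_eq (f := iota_lfun P)).
  congr (\dim _); apply/eqP; rewrite eqEsubv.
  apply/andP; split; apply/subvP => f.
    rewrite memv_cap memv_ker lfunE /= => /andP[Wf /eqP fpi0].
    have [g _ Df] := ker_push (subvP sWG _ Wf) fpi0.
    by rewrite Df -[g *m _](lfunE (mulmxr iota)) memv_img // UW -Df.
  move=> /memv_imgP[g Ug ->]; rewrite memv_cap memv_ker !lfunE /= -UW Ug /=.
  rewrite -mulmxA (_ : iota *m pi = 0) ?mulmx0 //.
  by apply/sub_kermxP; rewrite -exact_iota.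
apply/eqP; rewrite -subv0; apply/subvP => f.
rewrite memv_cap memv_ker lfunE memv0 /= -(mul0mx _ iota) => /andP[_ /eqP].
by move/(row_free_inj free_iota) ->.
Qed.

Lemma mem_hom_iota P (f : 'M_(rdegree P, rdegree A)) :
  (f \in hom_space [set: gT] P A) = (f *m iota \in hom_space [set: gT] P I).
Proof.
apply/idP/idP => [Gf | Gfi]; first exact: hom_spaceM Giota.
apply/hom_spaceP => x Gx; apply: (row_free_inj free_iota).
rewrite -mulmxA (hom_spaceP _ _ Gfi) // -!mulmxA.
by rewrite (hom_spaceP _ _ Giota).
Qed.

Lemma dim_hom_push P : higman P ->
  (\dim (hom_space [set: gT] P A) + \dim (hom_space [set: gT] P C))%N =
  \dim (hom_space [set: gT] P I).
Proof.
move=> higP; rewrite -push_surj //.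
rewrite -(limg_ker_dim (pi_lfun P) (hom_space _ _ I)).
rewrite (dim_ker_push (U := hom_space [set: gT] P A)) // => f.
exact: mem_hom_iota.
Qed.

Hypothesis higI : higman I.

(** The image of the cocycles of I consists of the coboundaries of C, because
    the cocycles of I are coboundaries and the cochains of I map onto those
    of C. *)
Lemma dim_cocycles_push i :
  (\dim (cocycles A Q i.+1) + \dim (coboundaries C Q i.+1))%N =
  \dim (cocycles I Q i.+1).
Proof.
have -> : coboundaries C Q i.+1 =
    (pi_lfun (Q i.+1) @: coboundaries I Q i.+1)%VS.
  rewrite /= -push_surj; last exact: res_higman.
  rewrite -!limg_comp; congr (_ @: _)%VS; apply/lfunP => f.
  by rewrite !comp_lfunE !lfunE /= mulmxA.
rewrite higman_coboundaries // -(limg_ker_dim (pi_lfun _) (cocycles I Q i.+1)).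
rewrite (dim_ker_push (U := cocycles A Q i.+1)) //; last exact: capvSl.
move=> f; rewrite !mem_cocycles -mem_hom_iota; congr (_ && _).
by rewrite mulmxA -(inj_eq (row_free_inj free_iota)) mul0mx.
Qed.

Lemma dim_coboundaries_le N i :
  (\dim (coboundaries N Q i) <= \dim (cocycles N Q i))%N.
Proof. exact/dimvS/coboundaries_sub. Qed.

(** Write d, z and b for the dimensions of cochains, cocycles and coboundaries,
    so that d_i = z_i + b_(i+1). Then z_i(A) + b_i(C) = z_i(I) = b_i(I) for
    i > 0 and d_i(A) + d_i(C) = d_i(I); eliminating the terms of I leaves
    z_(i+1)(A) - b_(i+1)(A) = z_i(C) - b_i(C) for i > 0. *)
Lemma rel_ext_dim_shift i : rel_ext_dim A Q i.+2 = rel_ext_dim C Q i.+1.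
Proof.
have zI := dim_cocycles_push i.+1; have zI' := dim_cocycles_push i.
have dA := dim_cochains A i.+1; have dI := dim_cochains I i.+1.
have dC := dim_cochains C i.+1; have dAIC := dim_hom_push (res_higman i.+1).
have := dim_coboundaries_le C i.+1; have := dim_coboundaries_le A i.+2.
rewrite /rel_ext_dim; rewrite (higman_coboundaries _ higI) in dI.
lia.
Qed.

(** The same count starting from degree 0, where the cocycles of I survive as
    the space of maps from M to I. *)
Lemma rel_ext_dim1 :
  (rel_ext_dim A Q 1 + \dim (hom_space [set: gT] M I))%N =
  (\dim (hom_space [set: gT] M A) + \dim (hom_space [set: gT] M C))%N.
Proof.
have zI := dim_cocycles_push 0.
have dA := dim_cochains A 0; have dI := dim_cochains I 0.
have dC := dim_cochains C 0; have dAIC := dim_hom_push (res_higman 0).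
have := dim_coboundaries_le A 1.
rewrite -!dim_cocycles0 /rel_ext_dim.
rewrite (higman_coboundaries _ higI) in dI.
lia.
Qed.

End DimensionShift.

End Cohomology.

End Higman.
(** * Maps out of the trivial module *)
Section Fixed.

Variables (k : fieldType) (gT : finGroupType).
Local Notation grepr := (representation k [set: gT]).
Implicit Types M N : grepr.

Lemma dim_hom_rsim M N N' :
  mx_rsim N N' ->
  \dim (hom_space [set: gT] M N) = \dim (hom_space [set: gT] M N').
Proof.
suff le N1 N2 : mx_rsim N1 N2 ->
    (\dim (hom_space [set: gT] M N1) <= \dim (hom_space [set: gT] M N2))%N.
  by move=> simN; apply/eqP; rewrite eqn_leq !le //; apply: mx_rsim_sym.
case=> B _ freeB homB.
have injB : lker (linfun (mulmxr B) : 'Hom('M[k]_(rdegree M, _), _)) == 0%VS.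
  by apply/lker0P => u v; rewrite !lfunE /= => /(row_free_inj freeB).
rewrite -(limg_dim_eq (f := linfun (mulmxr B))); last first.
  by rewrite (eqP injB) capv0.
apply/dimvS/subvP => _ /memv_imgP[f Gf ->]; rewrite lfunE /=.
by apply: hom_spaceM Gf _; apply/hom_spaceP => x Gx; rewrite homB.
Qed.

Lemma dim_hom_trivial (A : {set gT}) N m (K : 'M[k]_(m, rdegree N)) :
  <<A>>%g = [set: gT] -> row_free K ->
  (forall x, x \in A -> K *m N x = K) ->
  (forall v : 'rV_(rdegree N),
     (forall x, x \in A -> v *m N x = v) -> (v <= K)%MS) ->
  \dim (hom_space [set: gT] (trivial_repr k gT) N) = m.
Proof.
move=> genA freeK fixK spanK.
have injK : lker (linfun (mulmxr K) : 'Hom('rV[k]_m, _)) == 0%VS.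
  by apply/lker0P => u v; rewrite !lfunE /= => /(row_free_inj freeK).
transitivity (\dim (fullv : {vspace 'rV[k]_m})); last first.
  by rewrite dimvf dim_matrix; apply: mul1n.
rewrite -(limg_dim_eq (f := linfun (mulmxr K))); last first.
  by rewrite (eqP injK) capv0.
congr (\dim _); apply/eqP; rewrite eqEsubv; apply/andP; split; apply/subvP.
  move=> v /hom_spaceP Gv; have /submxP[u ->] : (v <= K)%MS.
    by apply: spanK => x _; rewrite -Gv ?inE // mul1mx.
  by rewrite -[u *m K](lfunE (mulmxr K)) memv_img ?memvf.
move=> _ /memv_imgP[u _ ->]; rewrite lfunE /=.
suff: u *m K \in hom_space <<A>> (trivial_repr k gT) N by rewrite genA.
by apply: hom_space_gen => x Ax; rewrite mul1mx -mulmxA fixK.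
Qed.

End Fixed.

(** * Representations of the Klein four-group by two commuting involutions *)
Section KleinFour.

Variables (k : fieldType) (gT : finGroupType) (sigma tau : gT).
Hypotheses (Gkl : klein_four sigma tau) (chark2 : 2%N \in [pchar k]).

Let abG : 2%N.-abelem [set: gT]. Proof. by case: Gkl. Qed.

Section KleinRepr.

Variables (d : nat) (S T : 'M[k]_d).
Hypotheses (SS : S *m S = 1%:M) (TT : T *m T = 1%:M) (ST : S *m T = T *m S).

Definition klein_mx (g : gT) : 'M[k]_d :=
  (if g \in <[tau]> then 1%:M else S) *m (if g \in <[sigma]> then 1%:M else T).

Lemma klein_mx_repr : mx_repr [set: gT] klein_mx.
Proof.
split=> [|x y _ _]; first by rewrite /klein_mx !group1 mulmx1.
have /negbRL := klein_four_notin x y (klein_fourC Gkl).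
have /negbRL := klein_four_notin x y Gkl; rewrite /klein_mx => -> ->.
case: (x \in <[tau]>); case: (x \in <[sigma]>);
  case: (y \in <[tau]>); case: (y \in <[sigma]>);
  rewrite /= ?(mulmx1, mul1mx) // ?mulmxA.
all: rewrite ?SS ?ST ?(mulmx1, mul1mx) //.
all: rewrite -?mulmxA ?SS ?TT ?mulmx1 //.
all: rewrite ?(mulmxA S S) ?(mulmxA T T) ?SS ?TT ?mul1mx //.
all: by rewrite ST mulmxA TT mul1mx.
Qed.

Definition klein_repr : representation k [set: gT] :=
  Representation (MxRepresentation klein_mx_repr).

Lemma klein_repr_sigma : klein_repr sigma = S.
Proof.
by rewrite /= /klein_mx cycle_id (negPf (klein_four_sigma Gkl)) mulmx1.
Qed.

Lemma klein_repr_tau : klein_repr tau = T.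
Proof.
rewrite /= /klein_mx cycle_id (negPf (klein_four_sigma (klein_fourC Gkl))).
by rewrite mul1mx.
Qed.

End KleinRepr.

(** * Matrices with entries 0 and 1

    In characteristic 2 these are added by exclusive disjunction, so that
    identities between them reduce to linear arithmetic on the indices. *)
Definition bmx m n (b : nat -> nat -> bool) : 'M[k]_(m, n) :=
  \matrix_(i, j) (b i j)%:R.

(** If row i stands for the monomial x^i y^(m-1-i), and columns likewise, this
    is the division by x^c y^(m-n-c). *)
Definition shift m n c := bmx m n (fun i j => i == (c + j)%N).

Lemma addb_natr (a b : bool) : a%:R + b%:R = (a (+) b)%:R :> k.
Proof.
have two0 : 1 + 1 = 0 :> k by exact: pcharf0 chark2.
by case: a b => [] []; rewrite ?two0 ?addr0 ?add0r.
Qed.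

Lemma bmxD m n b1 b2 :
  bmx m n b1 + bmx m n b2 = bmx m n (fun i j => b1 i j (+) b2 i j).
Proof. by apply/matrixP => i j; rewrite !mxE addb_natr. Qed.

Lemma eq_bmx m n b1 b2 :
  (forall i j, (i < m)%N -> (j < n)%N -> b1 i j = b2 i j) ->
  bmx m n b1 = bmx m n b2.
Proof. by move=> eqb; apply/matrixP => i j; rewrite !mxE eqb. Qed.

Lemma bmx_shift m n p c b :
  (c + p <= n)%N ->
  bmx m n b *m shift n p c = bmx m p (fun i j => b i (c + j)%N).
Proof.
move=> le_cp; apply/matrixP => i j; rewrite !mxE.
have lt_j : (c + j < n)%N by apply: leq_trans le_cp; rewrite ltn_add2l.
rewrite (bigD1 (Ordinal lt_j)) //= big1 ?addr0 => [|l /negPf]; rewrite !mxE.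
  by rewrite eqxx mulr1.
by rewrite -val_eqE /= => ->; rewrite mulr0.
Qed.

Lemma shift_bmx m n p c b :
  shift m n c *m bmx n p b =
    bmx m p (fun i j => (c <= i < c + n)%N && b (i - c)%N j).
Proof.
apply/matrixP => i j; rewrite !mxE;
  case: (boolP (c <= i < c + n)%N) => [/andP[le_ci lt_in] | out].
  have lt_l : (i - c < n)%N by rewrite ltn_subLR.
  rewrite (bigD1 (Ordinal lt_l)) //= big1 ?addr0 => [|l /negPf]; rewrite !mxE.
    by rewrite subnKC // eqxx mul1r.
  rewrite -val_eqE /= => l'i; case: eqP => [Di|]; last by rewrite mul0r.
  by rewrite Di addKn eqxx in l'i.
rewrite big1 // => l _; rewrite !mxE; case: eqP => [Di|]; last by rewrite mul0r.
by case/negP: out; rewrite Di leq_addr ltn_add2l /=.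
Qed.

Lemma shiftM m n p c d :
  (d + p <= n)%N -> shift m n c *m shift n p d = shift m p (c + d).
Proof.
move=> le_dp; rewrite /shift bmx_shift //; apply: eq_bmx => i j _ _.
by rewrite addnA.
Qed.

Definition ushift m n c := bmx m n (fun i j => j == (c + i)%N).

Lemma ushift_bmx m n p c b :
  (c + m <= n)%N ->
  ushift m n c *m bmx n p b = bmx m p (fun i j => b (c + i)%N j).
Proof.
move=> le_cm; apply/matrixP => i j; rewrite !mxE.
have lt_i : (c + i < n)%N by apply: leq_trans le_cm; rewrite ltn_add2l.
rewrite (bigD1 (Ordinal lt_i)) //= big1 ?addr0 => [|l /negPf]; rewrite !mxE.
  by rewrite eqxx mul1r.
by rewrite -val_eqE /= => ->; rewrite mul0r.
Qed.

Lemma bmx1 n : bmx n n (fun i j => i == j) = 1%:M.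
Proof. by apply/matrixP => i j; rewrite !mxE. Qed.

Lemma bmx0 m n : bmx m n (fun _ _ => false) = 0.
Proof. by apply/matrixP => i j; rewrite !mxE. Qed.

(** * The extension of V (n+2) by V n *)

(** For c = 1 this is the action of X on V n, and for c = 0 that of Y; with the
    same convention for c, ext_mx n c is the action of X or Y on F n. *)
Definition band n c : 'M[k]_(n.+1 + n) := block_mx 0 (shift n.+1 n c) 0 0.

Lemma VX_band n : VX_mx k n = band n 1.
Proof. by congr block_mx; apply/matrixP=> i j; rewrite !mxE. Qed.

Lemma VY_band n : VY_mx k n = band n 0.
Proof. by congr block_mx; apply/matrixP=> i j; rewrite !mxE. Qed.

Definition ext_mx n c : 'M[k]_((n.+3 + n.+2) + (n.+1 + n)) :=
  block_mx (band n.+2 c)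
    (block_mx (shift n.+3 n.+1 (c + c)) 0 0 (shift n.+2 n (c + c)))
    0 (band n c).

Lemma ext_mxM n c d : (c <= 1)%N -> (d <= 1)%N ->
  ext_mx n c *m ext_mx n d =
  block_mx 0
    (block_mx 0 (shift n.+3 n (c + (d + d)) + shift n.+3 n (c + c + d)) 0 0) 0 0.
Proof.
move=> c1 d1; rewrite /ext_mx /band !mulmx_block.
rewrite !(mulmx0, mul0mx, addr0, add0r, block_mx0, add_block_mx).
by rewrite !shiftM //; lia.
Qed.

Lemma ext_mx_sqr n c : (c <= 1)%N -> ext_mx n c *m ext_mx n c = 0.
Proof.
by move=> c1; rewrite ext_mxM // -[(c + c + c)%N]addnA addmm2 // !block_mx0.
Qed.

Lemma ext_mxC n c d : (c <= 1)%N -> (d <= 1)%N ->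
  ext_mx n c *m ext_mx n d = ext_mx n d *m ext_mx n c.
Proof.
move=> c1 d1; rewrite !ext_mxM // addrC.
by rewrite [(d + (c + c))%N]addnC [(c + (d + d))%N]addnC.
Qed.

Lemma ext_involution n c : (c <= 1)%N ->
  (1%:M + ext_mx n c) *m (1%:M + ext_mx n c) = 1%:M.
Proof.
move=> c1; rewrite mulmxDl !mulmxDr mul1mx mulmx1 ext_mx_sqr // addr0.
by rewrite mul1mx -addrA addmm2 // addr0.
Qed.

Lemma ext_commute n :
  (1%:M + ext_mx n 1) *m (1%:M + ext_mx n 0) =
  (1%:M + ext_mx n 0) *m (1%:M + ext_mx n 1).
Proof.
rewrite !mulmxDl !mulmxDr !mul1mx !mulmx1 ext_mxC // -!addrA; congr (_ + _).
by rewrite addrCA.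
Qed.

Definition ext_repr n :=
  klein_repr (ext_involution n (leqnn 1)) (ext_involution n (leq0n 1))
    (ext_commute n).

Lemma ext_repr_sigma n : ext_repr n sigma = 1%:M + ext_mx n 1.
Proof. exact: klein_repr_sigma. Qed.

Lemma ext_repr_tau n : ext_repr n tau = 1%:M + ext_mx n 0.
Proof. exact: klein_repr_tau. Qed.

Local Notation V := (V_repr Gkl chark2).

Lemma V_sigma n : V n sigma = 1%:M + band n 1.
Proof. by rewrite V_repr_sigma VX_band. Qed.

Lemma V_tau n : V n tau = 1%:M + band n 0.
Proof. by rewrite V_repr_tau VY_band. Qed.

Lemma hom_klein (M N : representation k [set: gT])
    (f : 'M[k]_(rdegree M, rdegree N)) :
  M sigma *m f = f *m N sigma -> M tau *m f = f *m N tau ->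
  f \in hom_space [set: gT] M N.
Proof.
have [_ _ genG] := Gkl; rewrite -genG => fs ft.
by apply: hom_space_gen => x /set2P[] ->.
Qed.

Lemma hom_cycle (M N : representation k [set: gT])
    (f : 'M[k]_(rdegree M, rdegree N)) x :
  M x *m f = f *m N x -> f \in hom_space <[x]> M N.
Proof. by move=> fx; apply: hom_space_gen => y /set1P ->. Qed.

Definition ext_incl n : 'M[k]_(rdegree (V n), rdegree (ext_repr n)) :=
  row_mx 0 1%:M.

Definition ext_proj n : 'M[k]_(rdegree (ext_repr n), rdegree (V n.+2)) :=
  col_mx 1%:M 0.

Lemma ext_incl_hom n : ext_incl n \in hom_space [set: gT] (V n) (ext_repr n).
Proof.
by apply: hom_klein; rewrite ?V_sigma ?V_tau ?ext_repr_sigma ?ext_repr_tau;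
  rewrite mulmxDl mulmxDr mul1mx mulmx1 /ext_incl mul_mx_row mul_row_block;
  rewrite !(mulmx0, mul0mx, addr0, add0r, mul1mx, mulmx1).
Qed.

Lemma ext_proj_hom n : ext_proj n \in hom_space [set: gT] (ext_repr n) (V n.+2).
Proof.
by apply: hom_klein; rewrite ?V_sigma ?V_tau ?ext_repr_sigma ?ext_repr_tau;
  rewrite mulmxDl mulmxDr mul1mx mulmx1 /ext_proj;
  rewrite [_ *m band _ _]mul_col_mx mul_block_col;
  rewrite !(mulmx0, mul0mx, addr0, add0r, mul1mx, mulmx1).
Qed.

Lemma ext_incl_free n : row_free (ext_incl n).
Proof.
apply/row_freeP; exists (col_mx 0 1%:M).
by rewrite mul_row_col mulmx0 add0r mulmx1.
Qed.

Lemma ext_exact n : (ext_incl n :=: kermx (ext_proj n))%MS.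
Proof.
apply/eqmxP/andP; split.
  by apply/sub_kermxP; rewrite mul_row_col mulmx0 mul0mx addr0.
apply/row_subP => i; have := row_sub i (kermx (ext_proj n)).
move: (row i _) => v /sub_kermxP.
rewrite -[v]hsubmxK mul_row_col mulmx0 addr0 mulmx1 => ->.
apply/submxP; exists (rsubmx v).
by rewrite mul_mx_row mulmx0 mulmx1.
Qed.

(** The identity on V (n+2), corrected on the b_i by a map phi to the a_i of V n
    and a map psi to the b_i of V n. *)
Definition ext_section n phi psi :
    'M[k]_(rdegree (V n.+2), rdegree (ext_repr n)) :=
  row_mx 1%:M (block_mx 0 0 phi psi).
Arguments ext_section : clear implicits.

Lemma ext_sectionK n phi psi : ext_section n phi psi *m ext_proj n = 1%:M.
Proof. by rewrite mul_row_col mulmx0 addr0 mulmx1. Qed.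

Lemma mul_section_ext n phi psi c :
  ext_section n phi psi *m ext_mx n c =
  row_mx (band n.+2 c) (block_mx (shift n.+3 n.+1 (c + c)) 0 0
     (shift n.+2 n (c + c) + phi *m shift n.+1 n c)).
Proof.
rewrite mul_row_block !mul1mx mulmx0 addr0 mulmx_block.
by rewrite !(mulmx0, mul0mx, addr0, add0r) add_block_mx !addr0.
Qed.

Lemma mul_band_section n phi psi c :
  band n.+2 c *m ext_section n phi psi =
  row_mx (band n.+2 c) (block_mx (shift n.+3 n.+2 c *m phi)
     (shift n.+3 n.+2 c *m psi) 0 0).
Proof.
rewrite mul_mx_row mulmx1 mulmx_block.
by rewrite !(mulmx0, mul0mx, addr0, add0r).
Qed.

(** Division by x (or y) composed with itself is division by x^2 (or y^2), which
    is the twist in the action on F n. *)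
Lemma section_hom n c : (c <= 1)%N ->
  band n.+2 c *m ext_section n (shift n.+2 n.+1 c) 0 =
  ext_section n (shift n.+2 n.+1 c) 0 *m ext_mx n c.
Proof.
move=> c1; rewrite mul_band_section mul_section_ext.
by rewrite mulmx0 !shiftM ?addmm2 //; lia.
Qed.

(** Here phi is division by x + y, whose square is division by x^2 + y^2; the
    term psi compensates for the action of XY on F n, since
    xy(x + y) = (x + y) xy. *)
Lemma section_hom_st n (phi := shift n.+2 n.+1 0 + shift n.+2 n.+1 1)
    (psi := shift n.+2 n 1) (s := ext_section n phi psi) :
  (1%:M + band n.+2 1) *m (1%:M + band n.+2 0) *m s =
  s *m ((1%:M + ext_mx n 1) *m (1%:M + ext_mx n 0)).
Proof.
rewrite !mulmxDl !mulmxDr !mulmxDl !mul1mx !mulmx1.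
rewrite -!addrA; congr (_ + _).
rewrite ext_mxM // [band _ _ *m band _ _]mulmx_block.
rewrite !(mulmx0, mul0mx, addr0, block_mx0).
rewrite !mul_band_section !mul_section_ext /s /ext_section mul_row_block.
rewrite !(mulmx0, mul0mx, addr0) mul1mx !add_row_mx !add_block_mx.
rewrite addr0 !(add0r, addr0); congr (row_mx _ _).
  by rewrite /band add_block_mx !addr0.
rewrite /phi !mulmxDl !mulmxDr !shiftM; try lia.
congr block_mx; rewrite -?[LHS]bmx0 !bmxD.
all: by apply: eq_bmx => i j _ _; lia.
Qed.

(** * The three subgroups of order 2 *)
Definition klein_chi : {set {group gT}} :=
  [set <[sigma]>%G; <[tau]>%G; <[(sigma * tau)%g]>%G].

Definition klein_compl (H : {group gT}) := if sigma \in H then tau else sigma.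

Lemma klein_sigmaM_notin : sigma \notin <[(sigma * tau)%g]>.
Proof.
have [_ oG genG] := Gkl; apply/negP => Hs.
have Ht : tau \in <[(sigma * tau)%g]> by rewrite -(groupMl _ Hs) cycle_id.
have [_ exp2] := abelemP (isT : prime 2) abG.
have: (#|[set: gT]| <= #[(sigma * tau)%g])%N.
  by rewrite subset_leq_card // -genG gen_subG subUset !sub1set Hs.
by rewrite oG leqNgt ltnS ltnW // ltnS dvdn_leq // order_dvdn exp2 ?inE.
Qed.

Lemma klein_compl_notin H : H \in klein_chi -> klein_compl H \notin H.
Proof.
rewrite !inE -orbA => /or3P[] /eqP ->; rewrite /klein_compl /=.
- by rewrite cycle_id (klein_four_sigma (klein_fourC Gkl)).
- by rewrite (negPf (klein_four_sigma Gkl)) (klein_four_sigma Gkl).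
by rewrite (negPf klein_sigmaM_notin) klein_sigmaM_notin.
Qed.

Lemma klein_index2 H : H \in klein_chi -> #|[set: gT] : H| = 2%N.
Proof.
have [_ oG _] := Gkl.
suff ox (x : gT) : x != 1%g -> #|[set: gT] : <[x]>| = 2%N.
  rewrite !inE -orbA => /or3P[] /eqP ->; apply: ox.
  - by apply: contraNneq (klein_four_sigma Gkl) => ->; apply: group1.
  - by apply: contraNneq (klein_four_sigma (klein_fourC Gkl)) => ->; apply: group1.
  apply: contraNneq (klein_four_sigma Gkl) => st1.
  by rewrite (canRL (mulgK tau) st1) mul1g groupV cycle_id.
move=> x1; have [_ exp2] := abelemP (isT : prime 2) abG.
rewrite -divgS ?subsetT // oG -orderE.
by rewrite (@nt_prime_order _ 2%N) ?exp2 ?inE.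
Qed.

Lemma klein_chi_distinct :
  [/\ (<[tau]>%G == <[sigma]>%G) = false,
      (<[(sigma * tau)%g]>%G == <[sigma]>%G) = false
    & (<[(sigma * tau)%g]>%G == <[tau]>%G) = false].
Proof.
have neq (x : gT) (H K : {group gT}) :
    x \in H -> x \notin K -> (K == H) = false.
  by move=> Hx; apply: contraNF => /eqP ->.
split.
- by apply: (neq sigma); rewrite ?cycle_id ?klein_four_sigma.
- by apply: (neq sigma); rewrite ?cycle_id ?klein_sigmaM_notin.
apply: (neq tau); rewrite ?cycle_id //.
apply: contra klein_sigmaM_notin => Ht.
by rewrite -(groupMr _ Ht) cycle_id.
Qed.

Lemma big_klein_chi (T : nmodType) (F : {group gT} -> T) :
  \sum_(H in klein_chi) F H =
  F <[sigma]>%G + F <[tau]>%G + F <[(sigma * tau)%g]>%G.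
Proof.
have [ts st_s st_t] := klein_chi_distinct.
rewrite /klein_chi setUC !big_setU1 ?big_set1 /=.
- by rewrite addrC.
- by rewrite inE eq_sym ts.
by rewrite !inE st_s st_t.
Qed.

(** * The middle term satisfies Higman's criterion *)

(** On F n, write A_i, B_i for the basis of the quotient V (n+2) and a_i, b_i
    for the basis of the submodule V n. With U = A_0, W = the sum of all A_i,
    T = A_(n+2) and E_i = the sum of the A_j with j > i, for 1 <= i <= n, the
    module F n is the direct sum of the free modules generated by the E_i and
    of the modules k[G/<sigma>], k[G/<sigma tau>] and k[G/<tau>] generated by
    U, W and T. The endomorphism theta_sigma inverts Y on the summands of the
    E_i and of U, theta_st inverts X on that of W, and theta_tau inverts X on
    that of T. All three kill the A_i; they map a_i through g to the span of
    the A_j, and B_i there through z followed by g; the components of the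
    image of b_i on the B_j and on the a_j are given by e and e'. *)
Definition ext_theta n (z : 'M[k]_(n.+2, n.+1)) (g : 'M[k]_(n.+1, n.+3))
    (e : 'M[k]_(n, n.+2)) (e' : 'M[k]_(n, n.+1)) :
    'M[k]_(rdegree (ext_repr n)) :=
  block_mx (block_mx 0 0 (z *m g) 0) 0 (block_mx g 0 0 e) (block_mx 0 0 e' 0).
Arguments ext_theta : clear implicits.

Lemma mul_ext_theta n z g e e' c :
  ext_mx n c *m ext_theta n z g e e' =
  block_mx
    (block_mx (shift n.+3 n.+2 c *m z *m g + shift n.+3 n.+1 (c + c) *m g) 0
              0 (shift n.+2 n (c + c) *m e))
    (block_mx 0 0 (shift n.+2 n (c + c) *m e') 0)
    (block_mx 0 (shift n.+1 n c *m e) 0 0)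
    (block_mx (shift n.+1 n c *m e') 0 0 0).
Proof.
rewrite /ext_theta /ext_mx /band !mulmx_block.
rewrite !(mulmx0, mul0mx, addr0, add0r) ?add_block_mx ?(addr0, add0r).
by rewrite ?[shift _ _ _ *m (z *m g)]mulmxA.
Qed.

Lemma mul_theta_ext n z g e e' c :
  ext_theta n z g e e' *m ext_mx n c =
  block_mx
    (block_mx 0 0 0 (z *m g *m shift n.+3 n.+2 c))
    (block_mx 0 0 (z *m g *m shift n.+3 n.+1 (c + c)) 0)
    (block_mx 0 (g *m shift n.+3 n.+2 c) 0 0)
    (block_mx (g *m shift n.+3 n.+1 (c + c)) 0
              0 (e *m shift n.+2 n (c + c) + e' *m shift n.+1 n c)).
Proof.
rewrite /ext_theta /ext_mx /band !mulmx_block.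
rewrite !(mulmx0, mul0mx, addr0, add0r) ?add_block_mx ?(addr0, add0r).
by rewrite ?[shift _ _ _ *m (z *m g)]mulmxA.
Qed.

(** The images of the a_i under the three endomorphisms. Put E_0 = U + W and
    E_(n+1) = T; then a_i = Y E_i + X E_(i+1) for 0 <= i <= n. Hence theta_sigma
    maps a_i to E_i for i > 0 and a_0 to U, theta_tau maps a_n to T, and
    theta_st maps a_0 to W. *)
Definition gamma_sigma n := bmx n.+1 n.+3
  (fun i j => (i == 0%N) && (j == 0%N) || (0 < i)%N && (i < j)%N).
Definition gamma_tau n := bmx n.+1 n.+3 (fun i j => (i == n) && (j == n.+2)).
Definition gamma_st n := bmx n.+1 n.+3 (fun i j => i == 0%N).

(** This is the sum of the three traces, evaluated on the A_i. *)
Lemma gamma_sum n :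
  shift n.+3 n.+2 0 *m shift n.+2 n.+1 1 *m gamma_sigma n
    + shift n.+3 n.+1 (0 + 0) *m gamma_sigma n
  + (shift n.+3 n.+2 1 *m shift n.+2 n.+1 0 *m gamma_tau n
    + shift n.+3 n.+1 (1 + 1) *m gamma_tau n)
  + (shift n.+3 n.+2 1 *m (shift n.+2 n.+1 0 + shift n.+2 n.+1 1) *m gamma_st n
    + shift n.+3 n.+1 (1 + 1) *m gamma_st n) = 1%:M.
Proof.
rewrite mulmxDr !shiftM; try lia.
rewrite mulmxDl !shift_bmx !bmxD -bmx1; apply: eq_bmx => i j lt_i lt_j.
rewrite ?(addn0, add0n) addbK.
case: i lt_i => [|[|i]] lt_i;
  rewrite ?subSS ?subn0 ?sub0n /= ?addn1 ?addbF ?ltnS.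
- lia.
- by case: n lt_i lt_j => [|n] lt_i lt_j /=; lia.
rewrite !andbF addbF; case: (ltngtP i n) => [lt_in|gt_in|->].
- by case: (ltngtP i.+1 n) => ? /=; lia.
- lia.
lia.
Qed.

Definition theta_sigma n := ext_theta n (shift _ _ 1) (gamma_sigma n)
  (ushift n n.+1 1 *m gamma_sigma n *m shift _ _ 1)
  (ushift n n.+1 1 *m gamma_sigma n *m shift _ _ 2).
Definition theta_tau n := ext_theta n (shift _ _ 0) (gamma_tau n) 0 0.
Definition theta_st n :=
  ext_theta n (shift _ _ 0 + shift _ _ 1) (gamma_st n) 0 0.

(** Equivariance rests on A_0, the image of a_0, being killed by X. *)
Lemma theta_sigma_hom n :
  ext_mx n 1 *m theta_sigma n = theta_sigma n *m ext_mx n 1.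
Proof.
rewrite mul_ext_theta mul_theta_ext !shiftM ?addmm2 //; try lia.
rewrite /gamma_sigma; congr (block_mx (block_mx _ _ _ _) (block_mx _ _ _ _)
  (block_mx _ _ _ _) (block_mx _ _ _ _)).
all: rewrite ?ushift_bmx; try lia.
all: rewrite ?mulmxA ?shiftM ?shift_bmx ?ushift_bmx ?bmx_shift; try lia.
all: rewrite ?bmxD -?[LHS]bmx0; apply: eq_bmx => i j lt_i lt_j.
all: lia.
Qed.

Lemma theta_tau_hom n :
  ext_mx n 0 *m theta_tau n = theta_tau n *m ext_mx n 0.
Proof.
rewrite mul_ext_theta mul_theta_ext !shiftM ?addmm2 //; try lia.
rewrite !(mul0mx, mulmx0, addr0).
rewrite /gamma_tau; congr (block_mx (block_mx _ _ _ _) (block_mx _ _ _ _)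
  (block_mx _ _ _ _) (block_mx _ _ _ _)).
all: rewrite ?mulmxA ?shiftM ?shift_bmx ?ushift_bmx ?bmx_shift; try lia.
all: rewrite ?bmxD -?[LHS]bmx0; apply: eq_bmx => i j lt_i lt_j.
all: lia.
Qed.

(** All rows of gamma_st are 0 or W, on which X and Y agree and XY vanishes. *)
Lemma theta_st_hom n :
  (1%:M + ext_mx n 1) *m (1%:M + ext_mx n 0) *m theta_st n =
  theta_st n *m ((1%:M + ext_mx n 1) *m (1%:M + ext_mx n 0)).
Proof.
rewrite !mulmxDl !mulmxDr !mulmxDl !mul1mx !mulmx1.
rewrite -!addrA; congr (_ + _).
rewrite ext_mxM // /theta_st !mul_ext_theta !mul_theta_ext.
rewrite /ext_theta !mulmx_block.
rewrite !(mulmx0, mul0mx, addr0, add0r, block_mx0) !add_block_mx !(addr0, add0r).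
set g := gamma_st n; set z := (shift _ n.+1 0 + shift _ _ 1).
have gC p c d : (c + p <= n.+3)%N -> (d + p <= n.+3)%N ->
    g *m shift n.+3 p c + g *m shift n.+3 p d = 0.
  by move=> cp dp; rewrite !bmx_shift // addmm2.
have zgC p c d : (c + p <= n.+3)%N -> (d + p <= n.+3)%N ->
    z *m g *m shift n.+3 p c + z *m g *m shift n.+3 p d = 0.
  by move=> cp dp; rewrite -!mulmxA -mulmxDr gC ?mulmx0.
have zC : shift n.+3 n.+2 0 *m z *m g + shift n.+3 n.+1 (0 + 0) *m g +
    (shift n.+3 n.+2 1 *m z *m g + shift n.+3 n.+1 (1 + 1) *m g) = 0.
  rewrite -!mulmxDl /z !mulmxDr !shiftM; try lia.
  rewrite !bmxD (_ : bmx _ _ _ = 0) ?mul0mx // -bmx0.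
  by apply: eq_bmx => i j _ _; lia.
rewrite zC !(mulmxDr g) (mulmxDr (z *m g)) !(gC, zgC); try lia.
by rewrite !add_block_mx !(addr0, add0r) !(gC, zgC) ?block_mx0 //; lia.
Qed.

Definition ext_top n : 'M[k]_(n.+3, rdegree (ext_repr n)) :=
  row_mx (row_mx 1%:M 0) 0.

(** The A_i generate F n: first a_i is obtained as Y E_i + X E_(i+1), then B_i
    as X A_i + a_(i-2), and b_i as X a_i. *)
Lemma ext_generated n f :
  f \in hom_space [set: gT] (ext_repr n) (ext_repr n) ->
  ext_top n *m f = ext_top n -> f = 1%:M.
Proof.
move=> /hom_spaceP Gf Uf; set d := rdegree _ in f Gf Uf *.
pose fixed m (w : 'M[k]_(m, d)) := w *m f = w.
have fixedD m (v w : 'M_(m, d)) : fixed _ v -> fixed _ w -> fixed _ (v + w).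
  by rewrite /fixed mulmxDl => -> ->.
have fixedM m p (v : 'M_(p, m)) (w : 'M_(m, d)) : fixed _ w -> fixed _ (v *m w).
  by rewrite /fixed -mulmxA => ->.
have fixedZ c m (w : 'M_(m, d)) :
    (c <= 1)%N -> fixed _ w -> fixed _ (w *m ext_mx n c).
  have comm x : ext_repr n x *m f = f *m ext_repr n x by apply: Gf; rewrite inE.
  case: c => [|[|//]] _ wf; rewrite /fixed.
    have := comm tau; rewrite ext_repr_tau mulmxDl mulmxDr mul1mx mulmx1.
    by move/addrI; rewrite -mulmxA => ->; rewrite mulmxA wf.
  have := comm sigma; rewrite ext_repr_sigma mulmxDl mulmxDr mul1mx mulmx1.
  by move/addrI; rewrite -mulmxA => ->; rewrite mulmxA wf.
have UZ c : ext_top n *m ext_mx n c =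
    row_mx (row_mx 0 (shift n.+3 n.+2 c)) (row_mx (shift n.+3 n.+1 (c + c)) 0).
  rewrite mul_row_block !mul0mx !addr0 mul_row_block !mul_row_block.
  by rewrite !(mul1mx, mul0mx, mulmx0, addr0).
have fa : fixed _ (row_mx 0 (row_mx 1%:M 0) : 'M_(n.+1, d)).
  have -> : row_mx 0 (row_mx 1%:M 0) =
      bmx n.+1 n.+3 (fun i j => i < j)%N *m (ext_top n *m ext_mx n 0) +
      bmx n.+1 n.+3 (fun i j => i.+1 < j)%N *m (ext_top n *m ext_mx n 1).
    rewrite !UZ !mul_mx_row !mulmx0 !add_row_mx !addr0 !bmx_shift; try lia.
    rewrite !bmxD; congr (row_mx _ (row_mx _ _)).
      rewrite -[LHS]row_mx0; congr row_mx.
      by rewrite -[LHS]bmx0; apply: eq_bmx => i j lt_i lt_j; lia.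
    by rewrite -bmx1; apply: eq_bmx => i j lt_i lt_j; lia.
  by apply: fixedD; apply: fixedM; apply: fixedZ.
have fB : fixed _ (row_mx (row_mx 0 1%:M) 0 : 'M_(n.+2, d)).
  have -> : row_mx (row_mx 0 1%:M) 0 = ushift n.+2 n.+3 1 *m
      (ext_top n *m ext_mx n 1 + shift n.+3 n.+1 2 *m row_mx 0 (row_mx 1%:M 0)).
    rewrite UZ !mul_mx_row !mulmx0 mulmx1 !add_row_mx !addr0 addmm2 //.
    rewrite !mul_mx_row !mulmx0 row_mx0 ushift_bmx; last lia.
    by rewrite -bmx1; congr (row_mx (row_mx _ _) _); apply: eq_bmx => i j _ _; lia.
  by apply/fixedM/fixedD; [apply: fixedZ | apply: fixedM].
have fb : fixed _ (row_mx 0 (row_mx 0 1%:M) : 'M_(n, d)).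
  have -> : row_mx 0 (row_mx 0 1%:M) = ushift n n.+1 1 *m
      ((row_mx 0 (row_mx 1%:M 0) : 'M_(n.+1, d)) *m ext_mx n 1).
    rewrite mul_row_block !mul0mx !add0r mul_row_block.
    rewrite !(mul1mx, mul0mx, mulmx0, addr0) !mul_mx_row !mulmx0 ushift_bmx; last lia.
    by rewrite -bmx1; congr (row_mx _ (row_mx _ _)); apply: eq_bmx => i j _ _; lia.
  by apply/fixedM/fixedZ.
have one_rows : col_mx (col_mx (ext_top n) (row_mx (row_mx 0 1%:M) 0))
    (col_mx (row_mx 0 (row_mx 1%:M 0)) (row_mx 0 (row_mx 0 1%:M))) = 1%:M :> 'M_d.
  rewrite [RHS]scalar_mx_block [RHS]block_mxEv; congr col_mx.
    by rewrite -block_mxEv block_mxEh col_mx0 -block_mxEv -scalar_mx_block.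
  by rewrite -block_mxEv block_mxEh col_mx0 -block_mxEv -scalar_mx_block.
by rewrite -[LHS]mul1mx -one_rows !mul_col_mx Uf fa fB fb.
Qed.

(** A sum of traces is G-equivariant, so it is the identity as soon as it fixes
    the generators A_i, where only one half of each trace is nonzero. *)
Lemma ext_higman n : higman klein_chi klein_compl (ext_repr n).
Proof.
pose theta H : 'M[k]_(rdegree (ext_repr n)) :=
  if H == <[sigma]>%G then theta_sigma n else
  if H == <[tau]>%G then theta_tau n else theta_st n.
have Htheta H : H \in klein_chi ->
    theta H \in hom_space H (ext_repr n) (ext_repr n).
  rewrite !inE -orbA /theta.
  case: eqP => [-> _ | _]; first apply: (hom_cycle (x := sigma)).
    by rewrite ext_repr_sigma mulmxDl mulmxDr theta_sigma_hom mul1mx mulmx1.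
  case: eqP => [-> _ | _ /= /eqP ->]; first apply: (hom_cycle (x := tau)).
    by rewrite ext_repr_tau mulmxDl mulmxDr theta_tau_hom mul1mx mulmx1.
  apply: (@hom_cycle (ext_repr n) (ext_repr n) (theta_st n) (sigma * tau)%g).
  rewrite repr_mxM ?inE // ext_repr_sigma ext_repr_tau.
  exact: theta_st_hom.
exists theta => //; apply: ext_generated.
  apply: memv_suml => H chiH.
  exact: (rel_trace_hom abG klein_index2 klein_compl_notin chiH (Htheta H chiH)).
have top_theta z g e e' : ext_top n *m ext_theta n z g e e' = 0.
  rewrite mul_row_block !mul0mx !addr0 mul_row_block mulmx0.
  by rewrite !(mul1mx, mul0mx, mulmx0, addr0) !row_mx0.
have top_trace c z g e e' (th := ext_theta n z g e e') :
    ext_top n *m ((1%:M + ext_mx n c) *m th + th *m (1%:M + ext_mx n c)) =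
    row_mx (row_mx
      (shift n.+3 n.+2 c *m z *m g + shift n.+3 n.+1 (c + c) *m g) 0) 0.
  rewrite mulmxDl [th *m _]mulmxDr mul1mx mulmx1 addrACA addmm2 // add0r.
  rewrite mulmxDr [X in _ + X]mulmxA top_theta mul0mx addr0 mul_ext_theta.
  rewrite mul_row_block !mul0mx !addr0 mul_row_block mulmx0 addr0.
  by rewrite !(mul1mx, mul0mx, mulmx0, addr0) mul_row_block
    !(mul1mx, mul0mx, mulmx0, addr0) !row_mx0.
rewrite (big_klein_chi (fun H =>
  @rel_trace _ _ (klein_compl H) (ext_repr n) (ext_repr n) (theta H))).
rewrite /theta mulmxDr [X in X + _]mulmxDr.
have [ts st_s st_t] := klein_chi_distinct.
have [cs ct cst] : [/\ klein_compl <[sigma]>%G = tau,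
    klein_compl <[tau]>%G = sigma & klein_compl <[(sigma * tau)%g]>%G = sigma].
  rewrite /klein_compl /= cycle_id (negPf (klein_four_sigma Gkl)).
  by rewrite (negPf klein_sigmaM_notin).
rewrite !eqxx ts st_s st_t cs ct cst.
rewrite /rel_trace ext_repr_sigma ext_repr_tau.
rewrite /theta_sigma /theta_tau /theta_st !top_trace !add_row_mx !addr0.
congr (row_mx (row_mx _ _) _).
exact: gamma_sum.
Qed.

(** * Fixed points *)
Lemma addkK (x y : k) : x + y + y = x.
Proof. by rewrite -addrA (addrr_pchar2 chark2) addr0. Qed.

Lemma mulmx_shiftE m n p c (M : 'M[k]_(m, n.+1)) i (j : 'I_p) :
  (c + p <= n.+1)%N -> (M *m shift n.+1 p c) i j = M i (inord (c + j)).
Proof.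
move=> le_cp; have lt_j : (c + j < n.+1)%N.
  by apply: leq_trans le_cp; rewrite ltn_add2l.
rewrite mxE (bigD1 (inord (c + j))) //= big1 ?addr0 => [|l /negPf]; rewrite !mxE.
  by rewrite inordK // eqxx mulr1.
by rewrite -val_eqE /= inordK // => ->; rewrite mulr0.
Qed.

(** Every monomial of positive degree is divisible by x or by y. *)
Lemma row_shift_eq0 n (p : 'rV[k]_n.+1) : (0 < n)%N ->
  p *m shift n.+1 n 0 = 0 -> p *m shift n.+1 n 1 = 0 -> p = 0.
Proof.
move=> n_gt0 p0 p1; apply/rowP => i; rewrite [RHS]mxE -[i]inord_val.
have [lt_in | le_ni] := ltnP i n.
  have := mulmx_shiftE p 0 (Ordinal lt_in) (leqW (leqnn n) : 0 + n <= n.+1)%N.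
  by rewrite p0 mxE => ->.
have i_gt0 : (0 < i)%N by apply: leq_trans le_ni.
have lt_i : (i.-1 < n)%N by rewrite prednK // -ltnS.
have := mulmx_shiftE p 0 (Ordinal lt_i) (leqnn _ : 1 + n <= n.+1)%N.
by rewrite p1 mxE add1n prednK // => ->.
Qed.

Lemma fixed_nilp m d (v : 'M[k]_(m, d)) N : v *m (1%:M + N) = v <-> v *m N = 0.
Proof.
rewrite mulmxDr mulmx1; split=> [/(canRL (addKr v)) -> | ->].
  by rewrite addNr.
by rewrite addr0.
Qed.

Lemma dim_fixed_V n :
  \dim (hom_space [set: gT] (trivial_repr k gT) (V n)) =
  if n is 0 then 1%N else n.
Proof.
have [_ _ genG] := Gkl.
case: n => [|n].
  have band0 c : band 0 c = 0.
    by rewrite /band [shift _ _ _]thinmx0 block_mx0.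
  apply: (dim_hom_trivial (K := 1%:M) genG); first by rewrite row_free_unit unitmx1.
    by move=> x /set2P[] ->; rewrite mul1mx ?V_sigma ?V_tau band0 addr0.
  by move=> v _; apply: submx1.
pose K : 'M[k]_(n.+1, rdegree (V n.+1)) := row_mx 0 1%:M.
apply: (dim_hom_trivial (K := K) genG).
- apply/row_freeP; exists (col_mx 0 1%:M).
  by rewrite mul_row_col mulmx0 add0r mulmx1.
- have fixK c : row_mx 0 1%:M *m (1%:M + band n.+1 c) = row_mx 0 1%:M.
    by apply/fixed_nilp; rewrite mul_row_block !(mulmx0, mul0mx, addr0) row_mx0.
  by move=> x /set2P[] ->; rewrite ?V_sigma ?V_tau.
move=> v fixv; have := fixv _ (set22 _ _); have := fixv _ (set21 _ _).
rewrite V_sigma V_tau -[v](@hsubmxK _ _ n.+2 n.+1) => /fixed_nilp fs /fixed_nilp ft.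
have vB c : row_mx (lsubmx v) (rsubmx v) *m band n.+1 c =
    row_mx 0 (lsubmx v *m shift n.+2 n.+1 c).
  by rewrite mul_row_block !(mulmx0, addr0).
move: fs ft; rewrite !vB -(row_mx0 _ 1 n.+2 n.+1).
move=> /eq_row_mx[_ fs] /eq_row_mx[_ ft].
rewrite (row_shift_eq0 _ ft fs) //.
by apply/submxP; exists (rsubmx v); rewrite mul_mx_row mulmx0 mulmx1.
Qed.

(** Besides the b_i, the fixed points of F n are spanned by YU = B_1 + a_0,
    XT = B_(n+2) + a_n and XW, the sum of all B_i and a_i. These are the first
    three rows of ext_fixed. *)
Definition fixed_B n := bmx 3 n.+2
  (fun i j => if i is 0 then j == 0 else if i is 1 then j == n.+1 else true)%N.
Definition fixed_a n := bmx 3 n.+1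
  (fun i j => if i is 0 then j == 0 else if i is 1 then j == n else true)%N.
Definition ext_fixed n : 'M[k]_(3 + n, rdegree (ext_repr n)) :=
  col_mx (row_mx (row_mx 0 (fixed_B n)) (row_mx (fixed_a n) 0))
         (row_mx (row_mx 0 0) (row_mx 0 1%:M)).

Lemma mul_fixed_B n (c : 'rV_3) j : (c *m fixed_B n) 0 j =
  c 0 0 * (j == 0 :> nat)%:R + c 0 1 * (j == n.+1 :> nat)%:R + c 0 2.
Proof.
rewrite !mxE !big_ord_recl big_ord0 !mxE /= addr0 mulr1 addrA.
by congr (_ + c _ _ * _ + c _ _); apply/val_inj.
Qed.

Lemma mul_fixed_a n (c : 'rV_3) j : (c *m fixed_a n) 0 j =
  c 0 0 * (j == 0 :> nat)%:R + c 0 1 * (j == n :> nat)%:R + c 0 2.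
Proof.
rewrite !mxE !big_ord_recl big_ord0 !mxE /= addr0 mulr1 addrA.
by congr (_ + c _ _ * _ + c _ _); apply/val_inj.
Qed.

Lemma dim_fixed_ext n :
  \dim (hom_space [set: gT] (trivial_repr k gT) (ext_repr n)) = (n + 3)%N.
Proof.
have [_ _ genG] := Gkl; rewrite addnC.
have row0 a b c d : 0 = row_mx (row_mx 0 0) (row_mx 0 0)
    :> 'rV[k]_((a + b) + (c + d)) by rewrite !row_mx0.
have vZ m c (p : 'M_(m, n.+3)) (q : 'M_(m, n.+2)) (r : 'M_(m, n.+1))
    (s : 'M_(m, n)) :
    row_mx (row_mx p q) (row_mx r s) *m ext_mx n c =
    row_mx (row_mx 0 (p *m shift n.+3 n.+2 c))
      (row_mx (p *m shift n.+3 n.+1 (c + c))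
              (q *m shift n.+2 n (c + c) + r *m shift n.+1 n c)).
  rewrite mul_row_block mulmx0 addr0 mul_row_block mul_row_block mul_row_block.
  by rewrite !(mulmx0, addr0, add0r) add_row_mx addr0.
have mulK (c : 'rV_3) (s : 'rV_n) : row_mx c s *m ext_fixed n =
    row_mx (row_mx 0 (c *m fixed_B n)) (row_mx (c *m fixed_a n) s).
  by rewrite mul_row_col !mul_mx_row !mulmx0 mulmx1 !add_row_mx !addr0 !add0r.
apply: (dim_hom_trivial (K := ext_fixed n) genG).
- rewrite -kermx_eq0; apply/rowV0P => v /sub_kermxP.
  rewrite -[v](@hsubmxK _ _ 3 n) mulK; set c := lsubmx v.
  rewrite (row0 n.+3 n.+2 n.+1 n).
  move=> /eq_row_mx[/eq_row_mx[_ cB] /eq_row_mx[ca ->]].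
  have c02 : c 0 0 + c 0 2 = 0.
    have := mul_fixed_B c (inord 0 : 'I_n.+2).
    by rewrite cB mxE inordK // eqxx mulr0 mulr1 addr0.
  have c12 : c 0 1 + c 0 2 = 0.
    have := mul_fixed_B c (inord n.+1 : 'I_n.+2).
    by rewrite cB mxE inordK // eqxx mulr0 mulr1 add0r.
  have c2 : c 0 2 = 0.
    have [n0 | n_gt0] := posnP n.
      have := mul_fixed_a c (inord 0 : 'I_n.+1).
      rewrite ca mxE inordK // eqxx n0 eqxx !mulr1 -addrA c12 addr0 => c0.
      by move: c02; rewrite -c0 add0r.
    have := mul_fixed_B c (inord 1 : 'I_n.+2).
    rewrite cB mxE inordK // eqSS [0%N == n]eq_sym (gtn_eqF n_gt0).
    by rewrite !mulr0 !add0r.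
  suff -> : c = 0 by rewrite row_mx0.
  move: c02 c12; rewrite c2 !addr0 => c0 c1.
  apply/rowP => i; rewrite [RHS]mxE.
  have /or3P[] : [|| i == 0, i == 1 | i == 2] by case: i => -[|[|[]]].
  1-3: by move/eqP->.
- have fixK c : (c <= 1)%N -> ext_fixed n *m (1%:M + ext_mx n c) = ext_fixed n.
    move=> c1; apply/fixed_nilp; rewrite mul_col_mx !vZ !mul0mx !addr0.
    rewrite !row_mx0 !bmx_shift; try lia.
    rewrite bmxD (_ : bmx _ _ _ = 0) ?row_mx0 ?col_mx0 // -bmx0.
    apply: eq_bmx => i j _ lt_j; move: c1.
    by case: i c => [|[|i]] [|[|//]] _ /=; lia.
  by move=> x /set2P[] ->; rewrite ?ext_repr_sigma ?ext_repr_tau; apply: fixK.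
move=> v fixv; have := fixv _ (set22 _ _); have := fixv _ (set21 _ _).
rewrite ext_repr_sigma ext_repr_tau -[v](@hsubmxK _ _ (n.+3 + n.+2) (n.+1 + n)).
move: (lsubmx v) (rsubmx v) => {v fixv} v w.
rewrite -[v]hsubmxK -[w]hsubmxK.
move: (lsubmx v) (rsubmx v) (lsubmx w) (rsubmx w) => {v w} p q r s.
move=> /fixed_nilp; rewrite vZ (row0 n.+3 n.+2 n.+1 n).
move=> /eq_row_mx[/eq_row_mx[_ ps] /eq_row_mx[_ qs]].
move=> /fixed_nilp; rewrite vZ (row0 n.+3 n.+2 n.+1 n).
move=> /eq_row_mx[/eq_row_mx[_ pt] /eq_row_mx[_ qt]].
rewrite (row_shift_eq0 _ pt ps) // {p ps pt}.
pose Q j := q 0 (inord j); pose R j := r 0 (inord j).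
have QR j : (j < n)%N -> Q j = R j.
  move=> lt_j; have := congr1 (fun M : 'rV_n => M 0 (Ordinal lt_j)) qt.
  rewrite mxE [RHS]mxE !mulmx_shiftE /=; try lia.
  by move/(canRL (addrK _)); rewrite sub0r (oppr_pchar2 chark2).
have QR1 j : (j < n)%N -> Q j.+2 = R j.+1.
  move=> lt_j; have := congr1 (fun M : 'rV_n => M 0 (Ordinal lt_j)) qs.
  rewrite mxE [RHS]mxE !mulmx_shiftE /=; try lia.
  by move/(canRL (addrK _)); rewrite sub0r (oppr_pchar2 chark2).
have Qconst j : (0 < j <= n)%N -> Q j = Q 1%N.
  elim: j => // -[|j] IHj // /andP[_ lt_jn].
  by rewrite QR1 -?QR ?IHj //; lia.
(* For n > 0 the middle coefficients Q 1, ..., Q n, R 1, ..., R (n-1) agree, and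
   c2 is their common value Q 1 because Q 0 = R 0; for n = 0 the same formulas
   solve the linear system for the three remaining coefficients. *)
pose d := R 0%N + Q 1%N; pose c2 := Q 0%N + d.
pose c : 'rV[k]_3 := \row_i (if val i is 0%N then d else
                             if val i is 1%N then Q n.+1 + c2 else c2).
apply/submxP; exists (row_mx c s); rewrite mulK.
have dc2 : d + c2 = Q 0%N by rewrite addrC addkK.
have Qc2 j : (0 < j <= n)%N -> Q j = c2.
  move=> j_n; rewrite Qconst // /c2 (QR 0%N); last lia.
  by rewrite addrA (addrr_pchar2 chark2) add0r.
congr (row_mx (row_mx _ _) (row_mx _ _)); apply/rowP => j.
  rewrite mul_fixed_B !mxE /= -[j in LHS]inord_val -/(Q j).
  have [-> | j0] := eqVneq (j : nat) 0%N; first by rewrite mulr0 mulr1 addr0.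
  have [-> | jn] := eqVneq (j : nat) n.+1.
    by rewrite mulr0 mulr1 add0r addkK.
  by rewrite !mulr0 !add0r Qc2 //; have := ltn_ord j; lia.
rewrite mul_fixed_a !mxE /= -[j in LHS]inord_val -/(R j).
have [-> | j0] := eqVneq (j : nat) 0%N.
  have [<- | n0] := eqVneq 0%N n; rewrite !mulr1 ?mulr0 ?addr0.
    by rewrite -addrA addkK /d addkK.
  by rewrite dc2 QR //; lia.
have [jn | jn] := eqVneq (j : nat) n; rewrite !mulr0 ?mulr1 !add0r.
  by rewrite addkK jn -[n in R n]prednK -?QR1 ?prednK //; lia.
by rewrite -QR ?Qc2 //; have := ltn_ord j; lia.
Qed.

(** * Cohomology of V n *)
Lemma ext_proj_split n H : H \in klein_chi ->
  exists2 s, s \in hom_space H (V n.+2) (ext_repr n) & s *m ext_proj n = 1%:M.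
Proof.
rewrite !inE -orbA => /or3P[] /eqP ->.
- exists (ext_section n (shift n.+2 n.+1 1) 0); last exact: ext_sectionK.
  apply: (@hom_cycle (V n.+2) (ext_repr n) _ sigma).
  by rewrite V_sigma ext_repr_sigma mulmxDl mulmxDr mul1mx mulmx1 section_hom.
- exists (ext_section n (shift n.+2 n.+1 0) 0); last exact: ext_sectionK.
  apply: (@hom_cycle (V n.+2) (ext_repr n) _ tau).
  by rewrite V_tau ext_repr_tau mulmxDl mulmxDr mul1mx mulmx1 section_hom.
exists (ext_section n (shift n.+2 n.+1 0 + shift n.+2 n.+1 1) (shift n.+2 n 1)).
  apply: (@hom_cycle (V n.+2) (ext_repr n) _ (sigma * tau)%g).
  rewrite !repr_mxM ?inE // V_sigma V_tau ext_repr_sigma ext_repr_tau.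
  exact: section_hom_st.
exact: ext_sectionK.
Qed.

Lemma rsim_ext_incl n (N : representation k [set: gT]) : mx_rsim N (V n) ->
  exists iota : 'M_(rdegree N, rdegree (ext_repr n)),
    [/\ iota \in hom_space [set: gT] N (ext_repr n), row_free iota
      & (iota :=: kermx (ext_proj n))%MS].
Proof.
case=> B eq_deg freeB homB; exists (B *m ext_incl n).
have fullB : row_full B by rewrite /row_full (eqP freeB); apply/eqP.
split; last exact: eqmx_trans (eqmxMfull _ fullB) (ext_exact n).
  by apply: hom_spaceM (ext_incl_hom n); apply/hom_spaceP.
by rewrite /row_free mxrankMfree ?ext_incl_free.
Qed.

Section RelExt.

Variables (Q : rel_resolution klein_chi (trivial_repr k gT)).

Lemma rel_ext_dim_V i n (N : representation k [set: gT]) :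
  mx_rsim N (V n) -> rel_ext_dim N Q i.+1 = (n + i.*2 - 1)%N.
Proof.
elim: i n N => [|i IHi] n N simN.
  have [iota [Giota free_iota exact_iota]] := rsim_ext_incl simN.
  have := rel_ext_dim1 chark2 abG klein_index2 klein_compl_notin Q Giota
    free_iota (ext_proj_hom n) exact_iota (@ext_proj_split n) (ext_higman n).
  rewrite dim_fixed_ext (dim_hom_rsim _ simN) !dim_fixed_V.
  by case: n {iota Giota free_iota exact_iota simN} => [|n]; lia.
have [iota [Giota free_iota exact_iota]] := rsim_ext_incl simN.
rewrite (rel_ext_dim_shift chark2 abG klein_index2 klein_compl_notin Q Giota
  free_iota (ext_proj_hom n) exact_iota (@ext_proj_split n) (ext_higman n)).
by rewrite (IHi n.+2 _ (mx_rsim_refl _)); lia.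
Qed.

End RelExt.

End KleinFour.

Theorem proposition20 (k : fieldType) (gT : finGroupType) (sigma tau : gT)
    (Gkl : klein_four sigma tau) (chark2 : 2%N \in [pchar k])
    (chi : {set {group gT}})
    (Dchi : chi = [set <[sigma]>%G; <[tau]>%G; <[(sigma * tau)%g]>%G])
    (n : nat) (N : representation k [set: gT])
    (isoN : mx_rsim N (V_repr Gkl chark2 n))
    (Q : rel_resolution chi (trivial_repr k gT)) :
  [/\ (0 < n)%N -> rel_ext_dim N Q 0 = n,
      n = 0%N -> rel_ext_dim N Q 0 = 1%N
    & forall i : nat, (0 < i)%N ->
        (rel_ext_dim N Q i)%:Z = Num.max 0 (n%:Z + 2 * i%:Z - 3)].
Proof.
have dim0 : rel_ext_dim N Q 0 = if n is 0 then 1%N else n.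
  rewrite /rel_ext_dim dimv0 subn0 dim_cocycles0.
  by rewrite (dim_hom_rsim _ isoN) dim_fixed_V.
split=> [n_gt0 | n0 | [//|i] _]; rewrite ?dim0.
- by case: n n_gt0 {isoN dim0}.
- by rewrite n0.
subst chi; rewrite (rel_ext_dim_V Q i isoN).
by case: ltP; lia.
Qed.
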